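(* Let $A$ be a commutative associative unital ring and let $n,m\geq 1$ be integers. If $n>m$, then there are no continuous homomorphisms of $A$-algebras from $\mathcal L^n(A)$ to $\mathcal L^m(A)$.
   Context: Rings and algebras are commutative, associative and unital. For $n\geq 1$, $\mathcal L^n(A)=A((t_1))\ldots((t_n))$ is the ring of iterated Laurent series over $A$ (inductively $\mathcal L^1(A)=A((t_1))=A[[t_1]][t_1^{-1}]$, $\mathcal L^n(A)=\mathcal L^{n-1}(A)((t_n))$). Elements are written $f=\sum_{l\in\mathbb Z^n}a_lt^l$ with $a_l\in A$ and $t^l=t_1^{l_1}\cdots t_n^{l_n}$, and $\mathrm{supp}(f)=\{l\in\mathbb Z^n: a_l\neq 0\}$. Put $\Lambda_1=\mathbb Z$, $\mathbb Z^1_\lambda=\{l\in\mathbb Z: l\geq\lambda\}$ for $\lambda\in\Lambda_1$, and for $n\geq 2$ put $\Lambda_n=\mathrm{Map}(\mathbb Z,\Lambda_{n-1})\times\mathbb Z$ (where $\mathrm{Map}$ denotes the set of all maps) and $\mathbb Z^n_\lambda=\bigcup_{l_n\geq\lambda_n}\mathbb Z^{n-1}_{\lambda'(l_n)}\times\{l_n\}$ for $\lambda=(\lambda',\lambda_n)\in\Lambda_n$. A formal series lies in $\mathcal L^n(A)$ iff its support is contained in $\mathbb Z^n_\lambda$ for some $\lambda\in\Lambda_n$. Topology: $\mathcal L^n(A)$ is an additive topological group with a base of open neighborhoods of zero given by the $A$-submodules $U_\lambda=\{f\in\mathcal L^n(A):\mathrm{supp}(f)\cap(-\mathbb Z^n_\lambda)=\varnothing\}$,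 $\lambda\in\Lambda_n$. Continuity of homomorphisms is with respect to these topologies.
   Formalization: The ring A is assumed to be nonzero; for A = 0 all the iterated Laurent series rings are zero and the zero map is a continuous homomorphism of A-algebras, so the claim fails there. *)

(* Defs.v *)
From HB Require Import structures.
From mathcomp Require Import all_boot all_order all_algebra.
From mathcomp Require Import zify ring.
From mathcomp Require Import all_classical topology tvs.

Set Implicit Arguments.
Unset Strict Implicit.
Unset Printing Implicit Defensive.

Import Order.TTheory GRing.Theory Num.Theory.

Local Open Scope classical_set_scope.
Local Open Scope ring_scope.

(** Laurent series: [laurent R] is R((t)). Rings are nonzero throughout: over
    the zero ring every A((t_1))...((t_n)) is zero, and zero maps are continuous
    homomorphisms between them. *)

Section LaurentType.
Context (R : comNzRingType).
Implicit Types f g h : int -> R.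

Definition bounded_below f := exists s : int, forall i, i < s -> f i = 0.

Record laurent := Laurent {
  lcoef :> int -> R;
  lcoef_asbool : `[< bounded_below lcoef >] }.

HB.instance Definition _ := [isSub for lcoef].
HB.instance Definition _ := [Choice of laurent by <:].

Lemma lcoef_bounded (f : laurent) : bounded_below f.
Proof. exact/asboolP/lcoef_asbool. Qed.

Definition mkLaurent f (fb : bounded_below f) : laurent := Laurent (asboolT fb).

Lemma laurentP (f g : laurent) : (forall i, f i = g i) -> f = g.
Proof. by move=> fg; apply/val_inj/funext. Qed.

Fact bounded0 : bounded_below (fun=> 0).
Proof. by exists 0. Qed.

Fact boundedN f : bounded_below f -> bounded_below (fun i => - f i).
Proof. by move=> [s fs]; exists s => i /fs ->; rewrite oppr0. Qed.

Fact boundedD f g :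
  bounded_below f -> bounded_below g -> bounded_below (fun i => f i + g i).
Proof.
move=> [s fs] [r gr]; exists (Num.min s r) => i; rewrite lt_min => /andP[lis lir].
by rewrite fs// gr// addr0.
Qed.

Definition laurent0 := mkLaurent bounded0.
Definition laurentN (f : laurent) := mkLaurent (boundedN (lcoef_bounded f)).
Definition laurentD (f g : laurent) :=
  mkLaurent (boundedD (lcoef_bounded f) (lcoef_bounded g)).

Fact laurentDA : associative laurentD.
Proof. by move=> f g h; apply: laurentP => i /=; rewrite addrA. Qed.
Fact laurentDC : commutative laurentD.
Proof. by move=> f g; apply: laurentP => i /=; rewrite addrC. Qed.
Fact laurent0D : left_id laurent0 laurentD.
Proof. by move=> f; apply: laurentP => i /=; rewrite add0r. Qed.
Fact laurentND : left_inverse laurent0 laurentN laurentD.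
Proof. by move=> f; apply: laurentP => i /=; rewrite addNr. Qed.

HB.instance Definition _ :=
  GRing.isZmodule.Build laurent laurentDA laurentDC laurent0D laurentND.

Lemma lcoef0 i : (0 : laurent) i = 0. Proof. by []. Qed.
Lemma lcoefN (f : laurent) i : (- f) i = - f i. Proof. by []. Qed.
Lemma lcoefD (f g : laurent) i : (f + g) i = f i + g i. Proof. by []. Qed.

(* A sum over all of Z; only finitely many terms are nonzero when f and g are
   bounded below, see [convE]. *)
Definition conv f g (k : int) : R := \sum_(i \in [set: int]) f i * g (k - i).

Lemma convE (s k : int) N f g :
    (forall i, i < s -> f i = 0) -> (forall i, i <= k - s - N%:Z -> g i = 0) ->
  conv f g k = \sum_(i < N) f (s + i%:Z) * g (k - s - i%:Z).
Proof.
move=> fs gN; pose r := [seq s + i%:Z | i <- iota 0 N].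
have r_uniq : uniq r.
  by rewrite map_inj_uniq ?iota_uniq// => i j; lia.
have -> : conv f g k = \sum_(i <- r) f i * g (k - i).
  rewrite fsbig_seq// /conv; apply/esym; apply: fsbig_widen => // i [_ /= ir].
  have [lis|lsi] := ltP i s; first by rewrite fs// mul0r.
  rewrite gN ?mulr0// leNgt; apply/negP => iN; apply: ir.
  by apply/mapP; exists (absz (i - s)); rewrite ?mem_iota; lia.
rewrite big_map -[X in iota 0 X]subn0 -/(index_iota 0 N) big_mkord.
by apply: eq_bigr => i _; congr (_ * g _); lia.
Qed.

Fact conv_bounded f g :
  bounded_below f -> bounded_below g -> bounded_below (conv f g).
Proof.
move=> [s fs] [r gr]; exists (s + r) => k ksr.
by rewrite (@convE s k 0) ?big_ord0// => i ik; apply: gr; lia.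
Qed.

Definition laurentM (f g : laurent) :=
  mkLaurent (conv_bounded (lcoef_bounded f) (lcoef_bounded g)).

Fact bounded1 : bounded_below (fun i => (i == 0)%:R).
Proof. by exists 0 => i i0; rewrite lt_eqF. Qed.

Definition laurent1 := mkLaurent bounded1.

Fact laurentMC : commutative laurentM.
Proof.
move=> f g; apply: laurentP => k /=; rewrite /conv.
rewrite (@reindex_fsbigT _ _ _ _ _ (fun i => k - i)); last first.
  by exists (fun i => k - i) => i; lia.
by apply: eq_fsbigr => i _; rewrite mulrC; congr (_ * _); congr (lcoef _ _); lia.
Qed.

Fact laurentMDl : left_distributive laurentM +%R.
Proof.
move=> f g h; apply: laurentP => k; rewrite lcoefD /=.
have [s fs] := lcoef_bounded f; have [r gr] := lcoef_bounded g.
have [p hp] := lcoef_bounded h.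
pose q : int := Num.min s r; pose N := absz (k - q - p + 1).
rewrite !(@convE q k N) => [|i iq|i iN|i iq|i iN|i iq|i iN].
all: try by [apply: hp; lia | apply: fs; lia | apply: gr; lia].
  by rewrite -big_split; apply: eq_bigr => i _; rewrite /= mulrDl.
by rewrite fs ?gr ?addr0//; lia.
Qed.

Fact laurent1M : left_id laurent1 laurentM.
Proof.
move=> f; apply: laurentP => k /=; have [s fs] := lcoef_bounded f.
pose N := absz (k - s + 1).
rewrite (@convE 0 k N.+1) => [|i i0|i iN]; first last.
- by apply: fs; lia.
- by rewrite lt_eqF.
rewrite big_ord_recl big1 ?addr0 /= ?eqxx ?mul1r ?subr0// => i _.
by rewrite mul0r.
Qed.

Fact laurentMA : associative laurentM.
Proof.
move=> f g h; apply: laurentP => k /=.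
have [a fa] := lcoef_bounded f; have [b gb] := lcoef_bounded g.
have [c hc] := lcoef_bounded h.
pose N := absz (k - a - b - c + 1).
have fgE i : conv f g i = 0 :> R \/ a + b <= i.
  have [iab|] := ltP i (a + b); last by right.
  by left; rewrite (@convE a i 0) ?big_ord0// => j ji; apply: gb; lia.
have ghE i : conv g h i = 0 :> R \/ b + c <= i.
  have [iab|] := ltP i (b + c); last by right.
  by left; rewrite (@convE b i 0) ?big_ord0// => j ji; apply: hc; lia.
rewrite (@convE a k N) => [|//|i iN]; last by case: (ghE i) => //; lia.
rewrite (@convE (a + b) k N) => [|i iab|i iN]; first last.
- by apply: hc; lia.
- by case: (fgE i) => //; lia.
under eq_bigr => j _.
  rewrite (@convE (b - j%:Z) _ N) => [|i ib|i iN]; first last.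
  - by apply: hc; lia.
  - by apply: gb; lia.
  rewrite mulr_sumr; over.
rewrite exchange_big /=; apply: eq_bigr => i _.
rewrite (@convE a _ N) => [|//|j jN]; last by apply: gb; have := ltn_ord i; lia.
rewrite mulr_suml; apply: eq_bigr => j _; rewrite mulrA.
by congr (_ * _ * _); congr (lcoef _ _); lia.
Qed.

Fact laurent1_neq0 : laurent1 != 0.
Proof.
by apply/eqP => /(congr1 (fun f : laurent => f 0))/eqP/=; rewrite oner_eq0.
Qed.

HB.instance Definition _ := GRing.Zmodule_isComNzRing.Build laurent
  laurentMA laurentMC laurent1M laurentMDl laurent1_neq0.

Lemma lcoefM (f g : laurent) k : (f * g) k = conv f g k. Proof. by []. Qed.
Lemma lcoef1 i : (1 : laurent) i = (i == 0)%:R. Proof. by []. Qed.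

End LaurentType.

Section LaurentAlgebra.
Context (K : comNzRingType) (R : comAlgType K).
Implicit Types (a b : K) (f g : laurent R).

Fact scale_bounded a (f : int -> R) :
  bounded_below f -> bounded_below (fun i => a *: f i).
Proof. by move=> [s fs]; exists s => i /fs ->; rewrite scaler0. Qed.

Definition laurent_scale a f := mkLaurent (scale_bounded a (lcoef_bounded f)).

Fact laurent_scaleA a b f :
  laurent_scale a (laurent_scale b f) = laurent_scale (a * b) f.
Proof. by apply: laurentP => i /=; rewrite scalerA. Qed.
Fact laurent_scale1 : left_id 1 laurent_scale.
Proof. by move=> f; apply: laurentP => i /=; rewrite scale1r. Qed.
Fact laurent_scaleDr : right_distributive laurent_scale +%R.
Proof. by move=> a f g; apply: laurentP => i /=; rewrite /= scalerDr. Qed.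
Fact laurent_scaleDl f : {morph laurent_scale^~ f : a b / a + b}.
Proof. by move=> a b; apply: laurentP => i /=; rewrite /= scalerDl. Qed.

HB.instance Definition _ := GRing.Zmodule_isLmodule.Build K (laurent R)
  laurent_scaleA laurent_scale1 laurent_scaleDr laurent_scaleDl.

Lemma lcoefZ a f i : (a *: f) i = a *: f i. Proof. by []. Qed.

Fact laurent_scaleAl a f g : a *: (f * g) = (a *: f) * g.
Proof.
apply: laurentP => k; rewrite lcoefZ !lcoefM.
have [s fs] := lcoef_bounded f; have [r gr] := lcoef_bounded g.
pose N := absz (k - s - r + 1).
rewrite !(@convE _ s k N) => [|i iq|i iN|i iq|i iN].
all: try by [apply: gr; lia | apply: fs; lia].
  by rewrite scaler_sumr; apply: eq_bigr => i _; rewrite /= scalerAl.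
by rewrite /= fs ?scaler0.
Qed.

HB.instance Definition _ :=
  GRing.Lmodule_isLalgebra.Build K (laurent R) laurent_scaleAl.
HB.instance Definition _ := GRing.Lalgebra_isComAlgebra.Build K (laurent R).

End LaurentAlgebra.

(** Iterated Laurent series: [iterLaurent A n] is A((t_1))...((t_n)). *)

Fixpoint iterLaurentAlg (A : comNzRingType) (n : nat) : comAlgType A :=
  if n is n'.+1 then laurent (iterLaurentAlg A n') else A^o.

Definition iterLaurent (A : comNzRingType) (n : nat) : Type :=
  iterLaurentAlg A n.

HB.instance Definition _ (A : comNzRingType) (n : nat) :=
  GRing.ComAlgebra.copy (iterLaurent A n) (iterLaurentAlg A n).

(* The coefficient of t^l. The outermost variable is the last one, so one
   first extracts the coefficient at the last entry of l. *)
Fixpoint icoef (A : comNzRingType) (n : nat) :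
    iterLaurent A n -> 'rV[int]_n -> A :=
  match n with
  | 0 => fun f _ => f
  | n'.+1 => fun (f : laurent (iterLaurentAlg A n')) l =>
      @icoef A n' (f (l 0 ord_max)) (col' ord_max l)
  end.

Definition supp (A : comNzRingType) (n : nat) (f : iterLaurent A n) :
    set 'rV[int]_n :=
  [set l | icoef f l != 0].

(* The case n = 0 is a convention: Z^0 is a single point. *)
Fixpoint Lam (n : nat) : Type :=
  match n with
  | 0 => unit
  | 1 => int
  | (_.+1 as n').+1 => (int -> Lam n') * int
  end.

Fixpoint Zlam (n : nat) : Lam n -> set 'rV[int]_n :=
  match n return Lam n -> set 'rV[int]_n with
  | 0 => fun _ => setT
  | n'.+1 =>
    match n' return (Lam n' -> set 'rV[int]_n') ->
                    Lam n'.+1 -> set 'rV[int]_n'.+1 with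
    | 0 => fun _ (lam : int) => [set l : 'rV[int]_1 | lam <= l 0 0]
    | n''.+1 => fun Zn' (lam : (int -> Lam n''.+1) * int) =>
        [set l : 'rV[int]_n''.+2 | lam.2 <= l 0 ord_max /\
           Zn' (lam.1 (l 0 ord_max)) (col' ord_max l)]
    end (@Zlam n')
  end.

Definition Ulam (A : comNzRingType) (n : nat) (lam : Lam n) :
    set (iterLaurent A n) :=
  [set f | supp f `&` (-%R @` Zlam lam) = set0].

Lemma icoefD (A : comNzRingType) n (f g : iterLaurent A n) l :
  icoef (f + g) l = icoef f l + icoef g l.
Proof. by elim: n f g l => [//|n IHn] f g l; exact: IHn. Qed.

Lemma icoef0 (A : comNzRingType) n l : icoef (0 : iterLaurent A n) l = 0.
Proof. by elim: n l => [//|n IHn] l; exact: IHn. Qed.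

Lemma icoefN (A : comNzRingType) n (f : iterLaurent A n) l :
  icoef (- f) l = - icoef f l.
Proof. by elim: n f l => [//|n IHn] f l; exact: IHn. Qed.

Lemma icoefZ (A : comNzRingType) n (a : A) (f : iterLaurent A n) l :
  icoef (a *: f) l = a * icoef f l.
Proof. by elim: n f l => [//|n IHn] f l; exact: IHn. Qed.

(** Formal series over Z^n with support in some [Zlam lam] are exactly the
    elements of [iterLaurent A n]. *)

Definition snoc n (l : 'rV[int]_n) (i : int) : 'rV[int]_n.+1 :=
  \row_j oapp (l 0) i (unlift ord_max j).
Lemma snoc_last n (l : 'rV[int]_n) i : snoc l i 0 ord_max = i.
Proof. by rewrite mxE unlift_none. Qed.
Lemma col'_snoc n (l : 'rV[int]_n) i : col' ord_max (snoc l i) = l.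
Proof. by apply/rowP => j; rewrite !mxE liftK. Qed.
Lemma snocK n (l : 'rV[int]_n.+1) : snoc (col' ord_max l) (l 0 ord_max) = l.
Proof.
by apply/rowP => j; rewrite !mxE; case: unliftP => [k ->|->]/=; rewrite ?mxE.
Qed.

Lemma rV1 (l : 'rV[int]_1) : l 0 ord_max = l 0 0.
Proof. by congr (l _ _); apply: val_inj. Qed.

Lemma ZlamS n (lam : (int -> Lam n.+1) * int) l i :
  @Zlam n.+2 lam (snoc l i) <-> lam.2 <= i /\ Zlam (lam.1 i) l.
Proof. by rewrite /= !snoc_last col'_snoc. Qed.

Lemma icoef_supp (A : comNzRingType) n (f : iterLaurent A n) :
  exists lam : Lam n, supp f `<=` Zlam lam.
Proof.
elim: n f => [|[|n] IHn] f; first by exists tt.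
  have [s fs] := lcoef_bounded f; exists s => l; rewrite /supp /= => fl.
  rewrite leNgt; apply/negP => ls; move/eqP: fl; apply.
  by rewrite rV1 fs.
have [s fs] := lcoef_bounded f.
have [lam lamP] := choice (fun i => IHn (lcoef f i)).
exists (lam, s) => l fl; split => /=.
  rewrite leNgt; apply/negP => ls; move/eqP: fl; apply => /=.
  rewrite fs//. exact: icoef0.
exact: lamP.
Qed.

Lemma icoef_ex (A : comNzRingType) n (a : 'rV[int]_n -> A) (lam : Lam n) :
  [set l | a l != 0] `<=` Zlam lam -> exists! f : iterLaurent A n, icoef f = a.
Proof.
elim: n a lam => [|n IHn] a lam alam.
  exists (a 0); split => [|f <-//]; apply/funext => l; congr a; apply/rowP; case=> //.
have key : exists s : int, forall i, exists mu : Lam n,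
    (i < s -> forall l, a (snoc l i) = 0) /\
    [set l | a (snoc l i) != 0] `<=` Zlam mu.
  case: n IHn a lam alam => [|n] IHn a lam alam.
    exists lam => i; exists tt; split=> // il l.
    apply/eqP/negPn/negP => /alam /=; rewrite -rV1 snoc_last.
    by rewrite leNgt il.
  exists lam.2 => i; exists (lam.1 i); split.
    move=> il l; apply/eqP/negPn/negP => /alam /ZlamS[]; by rewrite leNgt il.
  by move=> l /= /alam /ZlamS[].
have [s /choice[mu muP]] := key.
have /choice[F FP] : forall i, exists f : iterLaurent A n,
    icoef f = (fun l => a (snoc l i)) /\
    forall g : iterLaurent A n, icoef g = (fun l => a (snoc l i)) -> g = f.
  move=> i; have [f [f1 f2]] := IHn (fun l => a (snoc l i)) _ (muP i).2.
  by exists f; split => // g /f2.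
have Fb : bounded_below (F : int -> iterLaurentAlg A n).
  exists s => i si; apply/esym/(FP i).2; apply/funext => l.
  by rewrite icoef0 (muP i).1.
exists (mkLaurent Fb); split => [|g ga].
  by apply/funext => l /=; rewrite (FP _).1 snocK.
apply: laurentP => i /=; apply/esym/(FP i).2/funext => l; rewrite -ga /=.
by rewrite snoc_last col'_snoc.
Qed.

(** The topology with the [Ulam] as base of neighborhoods of zero. *)

Lemma UlamP (A : comNzRingType) n (lam : Lam n) (f : iterLaurent A n) :
  Ulam lam f <-> forall l, Zlam lam l -> icoef f (- l) = 0.
Proof.
split=> [f0 l lamP|f0].
  apply/eqP/negP => fl; suff: set0 (- l) by [].
  by rewrite -f0; split; [exact/negP | exists l].
apply/seteqP; split=> [k|k []] [/eqP fk [l lamP lE]].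
by apply: fk; rewrite -lE f0.
Qed.

Lemma Ulam0 (A : comNzRingType) n (lam : Lam n) : Ulam lam (0 : iterLaurent A n).
Proof. by apply/UlamP => l _; rewrite icoef0. Qed.

Lemma UlamD (A : comNzRingType) n (lam : Lam n) (f g : iterLaurent A n) :
  Ulam lam f -> Ulam lam g -> Ulam lam (f + g).
Proof.
move=> /UlamP f0 /UlamP g0; apply/UlamP => l lamP.
by rewrite icoefD f0// g0// addr0.
Qed.

Lemma UlamN (A : comNzRingType) n (lam : Lam n) (f : iterLaurent A n) :
  Ulam lam f -> Ulam lam (- f).
Proof. by move=> /UlamP f0; apply/UlamP => l lamP; rewrite icoefN f0// oppr0. Qed.

Lemma UlamZ (A : comNzRingType) n (lam : Lam n) (a : A) (f : iterLaurent A n) :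
  Ulam lam f -> Ulam lam (a *: f).
Proof. by move=> /UlamP f0; apply/UlamP => l lamP; rewrite icoefZ f0// mulr0. Qed.

Lemma Zlam_directed n (lam mu : Lam n) :
  exists nu : Lam n, Zlam lam `|` Zlam mu `<=` Zlam nu.
Proof.
elim: n lam mu => [|[|n] IHn] lam mu; first by exists tt.
  by exists (Num.min lam mu) => l [] /= ll; rewrite ge_min ll ?orbT.
have [nu nuP] := choice (fun i => IHn (lam.1 i) (mu.1 i)).
exists (nu, Num.min lam.2 mu.2) => l [] [/= l2 l1]; rewrite ge_min l2 ?orbT.
  by split=> //; apply: nuP; left.
by split=> //; apply: nuP; right.
Qed.

Lemma Ulam_directed (A : comNzRingType) n (lam mu : Lam n) :
  exists nu : Lam n, @Ulam A n nu `<=` Ulam lam `&` Ulam mu.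
Proof.
have [nu nuP] := Zlam_directed lam mu; exists nu => f /UlamP f0.
by split; apply/UlamP => l lP; apply: f0; apply: nuP; [left|right].
Qed.

Definition inhabLam n : Lam n.
Proof. by elim: n => [|[|n] lam]; [exact: tt | exact: 0 | exact: (fun=> lam, 0)]. Defined.

Section Topology.
Context (A : comNzRingType) (n : nat).
Local Notation L := (iterLaurent A n).

Definition iter_nbhs (f : L) : set_system L :=
  [set V | exists lam : Lam n, forall u, Ulam lam u -> V (f + u)].

HB.instance Definition _ := hasNbhs.Build L iter_nbhs.

Fact iter_nbhs_filter (f : L) : ProperFilter (iter_nbhs f).
Proof.
split; first by move=> [lam /(_ 0 (Ulam0 _ _))].
split.
- by exists (inhabLam n).
- move=> V W [lam lamV] [mu muW]; have [nu nuP] := @Ulam_directed A n lam mu.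
  by exists nu => u /nuP[ul um]; split; [exact: lamV | exact: muW].
- by move=> V W VW [lam lamV]; exists lam => u /lamV/VW.
Qed.

Fact iter_nbhs_singleton (f : L) V : iter_nbhs f V -> V f.
Proof. by move=> [lam /(_ 0 (Ulam0 _ _))]; rewrite addr0. Qed.

Fact iter_nbhs_nbhs (f : L) V : iter_nbhs f V -> iter_nbhs f (iter_nbhs^~ V).
Proof.
move=> [lam lamV]; exists lam => u ul; exists lam => v vl.
by rewrite -addrA; apply/lamV/UlamD.
Qed.

HB.instance Definition _ := Nbhs_isNbhsTopological.Build L
  iter_nbhs_filter iter_nbhs_singleton iter_nbhs_nbhs.

Fact iter_sub_continuous : continuous (fun x : L * L => x.1 - x.2).
Proof.
move=> [f g] /= V [lam lamV].
exists ([set f + u | u in Ulam lam], [set g + u | u in Ulam lam]) => /=.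
  by split; exists lam => u ul; exists u.
move=> [_ _] /= [[u ul <-] [v vl <-]].
have -> : f + u - (g + v) = f - g + (u - v) by rewrite opprD addrACA.
by apply/lamV/UlamD => //; exact: UlamN.
Qed.

HB.instance Definition _ :=
  PreTopologicalNmodule_isTopologicalZmodule.Build L iter_sub_continuous.

End Topology.

(* Main.v *)
Require Import Defs.
From HB Require Import structures.
From mathcomp Require Import all_boot all_order all_algebra.
From mathcomp Require Import zify.
From mathcomp Require Import all_classical topology.

Set Implicit Arguments.
Unset Strict Implicit.
Unset Printing Implicit Defensive.

Import Order.TTheory GRing.Theory Num.Theory.

Local Open Scope classical_set_scope.
Local Open Scope ring_scope.

(** Fix a prime ideal P of A. Modulo P, every unit of L^m(A) has a leading
    exponent in Z^m for the lexicographic order, and leading exponents add up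
    under products. So a homomorphism phi from L^n(A) to L^m(A) induces a group
    homomorphism l |-> lead (phi t^l) from Z^n to Z^m, which for n > m kills some
    l <> 0. All the phi t^(kl), k in Z, then have a coefficient at t^0 outside P
    and stay out of a fixed neighborhood of zero, whereas every neighborhood of
    zero in L^n(A) contains some t^(kl). Hence phi is not continuous. *)

(** * Existence of prime ideals *)

Definition ideal (R : comNzRingType) (I : set R) :=
  [/\ I 0, forall x y, I x -> I y -> I (x + y) & forall a x, I x -> I (a * x)].

Definition prime_ideal (R : comNzRingType) (I : set R) :=
  [/\ ideal I, ~ I 1 & forall x y, I (x * y) -> I x \/ I y].

(** Zorn's lemma gives a maximal proper ideal, and such an ideal is prime. *)
Lemma prime_ideal_ex (R : comNzRingType) : exists I : set R, prime_ideal I.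
Proof.
(* The empty set is added for the union of the empty chain. *)
pose proper (I : set R) := I = set0 \/ ideal I /\ ~ I 1.
have [F Fproper totF|M [Mproper Mmax]] := @Zorn_bigcup R proper.
  have [[X FX X0]|F0] := pselect (exists2 X, F X & X !=set0); last first.
    left; apply/seteqP; split => // x [X FX Xx].
    by case: F0; exists X => //; exists x.
  have idF Y y : F Y -> Y y -> ideal Y /\ ~ Y 1.
    by move=> FY Yy; case: (Fproper Y FY) => // Y0; rewrite Y0 in Yy.
  right; split; last by move=> [Y FY Y1]; case: (idF _ _ FY Y1).
  split.
  - by exists X => //; have [x /(idF _ _ FX)[[]]] := X0.
  - move=> x y [Y FY Yx] [Z FZ Zy].
    have [[_ YD _] _] := idF _ _ FY Yx; have [[_ ZD _] _] := idF _ _ FZ Zy.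
    have [YZ|ZY] := totF _ _ FY FZ.
      by exists Z => //; apply: ZD => //; exact: YZ.
    by exists Y => //; apply: YD => //; exact: ZY.
  - move=> a x [Y FY Yx]; exists Y => //.
    by have [[_ _ +] _] := idF _ _ FY Yx; apply.
have {Mproper}[[M0 MD MM] M1] : ideal M /\ ~ M 1.
  (* The maximal element is not empty, since the zero ideal is proper. *)
  case: Mproper => // M0; exfalso; apply: (Mmax [set 0]); last first.
    right; split; last by move=> /eqP; rewrite oner_eq0.
    split=> // [x y -> ->|a x ->]; first by rewrite /= addr0.
    by rewrite /= mulr0.
  by rewrite M0; split=> [? []|/(_ 0 erefl)].
(* By maximality, [M] and an [x] outside it generate the unit ideal. *)
have coprime x : ~ M x -> exists a b, M b /\ 1 = a * x + b.
  move=> Mx; pose J := [set z | exists a b, M b /\ z = a * x + b].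
  have Jx : J x by exists 1, 0; rewrite mul1r addr0.
  have [//|J1] := pselect (J 1); exfalso; apply: (Mmax J).
    split; last by move/(_ x Jx).
    by move=> b Mb; exists 0, b; rewrite mul0r add0r.
  right; split=> //; split.
  - by exists 0, 0; rewrite mul0r addr0.
  - move=> _ _ [a [b [Mb ->]]] [c [d [Md ->]]]; exists (a + c), (b + d).
    by split; [exact: MD | rewrite mulrDl addrACA].
  - move=> c _ [a [b [Mb ->]]]; exists (c * a), (c * b).
    by split; [exact: MM | rewrite mulrDr mulrA].
exists M; split=> // x y Mxy.
have [|/coprime[a [b [Mb e1]]]] := pselect (M x); [by left|right].
by rewrite -[y]mul1r e1 mulrDl -mulrA [b * y]mulrC; apply: MD; apply: MM.
Qed.

(** The convolution is a finite sum, and all its terms but the one at [a] lie in [I]. *)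
Lemma conv_mod_ideal (R : comNzRingType) (I : set R) (f g : laurent R)
    (k a : int) :
    ideal I -> (forall i, i != a -> I (f i * g (k - i))) ->
  exists2 z, I z & (f * g) k = f a * g (k - a) + z.
Proof.
move=> [I0 ID _] fgI.
have [s fs] := lcoef_bounded f; have [r gr] := lcoef_bounded g.
(* The range from [q] to [q + N - 1] contains [a] and every index with a nonzero term. *)
pose q : int := Num.min s a; pose N := (`|(a - q)%R| + `|(k - q - r)%R|).+1%N.
have lt_aN : (absz (a - q) < N)%N by lia.
have eq_a : q + (absz (a - q))%:Z = a by lia.
rewrite lcoefM (@convE _ q k N) => [|i iq|i iN]; [|apply: fs; lia|apply: gr; lia].
rewrite (bigD1 (Ordinal lt_aN)) //= eq_a -addrA -opprD eq_a.
eexists; last reflexivity.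
elim/big_ind: _ => // i ia; rewrite -addrA -opprD; apply: fgI.
by have : nat_of_ord i != absz (a - q) by []; lia.
Qed.

(** * Leading exponents modulo a prime ideal *)

Section LeadingExponent.
Variables (A : comNzRingType) (P : set A).
Hypothesis primeP : prime_ideal P.

(** For an ideal [P], this is the kernel of the coefficientwise reduction to series over A/P; using
    it avoids forming the quotient. *)
Fixpoint coefs_in (n : nat) : set (iterLaurentAlg A n) :=
  match n with
  | 0 => P
  | n'.+1 => fun f : laurent (iterLaurentAlg A n') => forall i, coefs_in (f i)
  end.

(* [lead f l]: modulo P, the exponent l is the smallest one in the support of f
   for the lexicographic order in which the last entry dominates. *)
Fixpoint lead (n : nat) : iterLaurentAlg A n -> 'rV[int]_n -> Prop :=
  match n with
  | 0 => fun f _ => ~ P f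
  | n'.+1 => fun (f : laurent (iterLaurentAlg A n')) l =>
      (forall i, i < l 0 ord_max -> coefs_in (f i)) /\
      lead (f (l 0 ord_max)) (col' ord_max l)
  end.

Lemma ideal_coefs_in n : ideal (@coefs_in n).
Proof.
elim: n => [|n [I0 ID IM]] /=; first by case: primeP.
split=> [i|f g fI gI i|f g gI k]; first exact: I0.
  by apply: ID; [exact: fI|exact: gI].
(* The index 0 is arbitrary: every term of the convolution lies in the ideal. *)
have [|i _|z Iz ->] := @conv_mod_ideal _ (@coefs_in n) f g k 0.
- by split.
- by apply: IM; exact: gI.
- by apply: ID => //; apply: IM; exact: gI.
Qed.

Lemma coefs_in0 n : @coefs_in n 0. Proof. by case: (ideal_coefs_in n). Qed.

Lemma coefs_inD n f g : @coefs_in n f -> coefs_in g -> coefs_in (f + g).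
Proof. by case: (ideal_coefs_in n) => _ + _; apply. Qed.

Lemma coefs_inM n f g : @coefs_in n g -> coefs_in (f * g).
Proof. by case: (ideal_coefs_in n) => _ _; apply. Qed.

Lemma coefs_in1 n : ~ @coefs_in n 1.
Proof. by elim: n => [|n IHn] /=; [case: primeP | move=> /(_ 0)]. Qed.

Lemma lead_icoef n (f : iterLaurentAlg A n) l :
  lead f l -> ~ P (@icoef A n f l).
Proof. by elim: n f l => [//|n IHn] f l /= [_ /IHn]. Qed.

Lemma lead_coefs_in n (f : iterLaurentAlg A n) l : lead f l -> ~ coefs_in f.
Proof. by elim: n f l => [//|n IHn] f l /= [_ /IHn fl] /(_ (l 0 ord_max)). Qed.

(** If the last entries differed, the coefficient at the smaller one would lie in the ideal and yet
    have a leading exponent. *)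
Lemma lead_uniq n (f : iterLaurentAlg A n) l l' :
  lead f l -> lead f l' -> l = l'.
Proof.
elim: n f l l' => [|n IHn] f l l' /=; first by move=> _ _; apply/rowP; case.
move=> [fl ll] [fl' ll']; rewrite -[l]snocK -[l']snocK.
suff e : l 0 ord_max = l' 0 ord_max.
  by rewrite e in ll *; rewrite (IHn _ _ _ ll ll').
case: (ltgtP (l 0 ord_max) (l' 0 ord_max)) => // [/fl'|/fl].
  by move/lead_coefs_in: ll.
by move/lead_coefs_in: ll'.
Qed.

(** Supports are bounded below in the last variable, so a least index has its coefficient outside
    the ideal; recurse into that coefficient. *)
Lemma lead_ex n (f : iterLaurentAlg A n) : ~ coefs_in f -> exists l, lead f l.
Proof.
elim: n f => [|n IHn] /= f; first by exists 0.
move=> /existsNP[i fi]; have [s fs] := lcoef_bounded f.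
have ex : exists k : nat, `[< ~ coefs_in (lcoef f (s + k%:Z)) >].
  exists (absz (i - s)); apply/asboolP; have [lt_is|le_si] := ltP i s.
    by exfalso; apply: fi; rewrite fs//; exact: coefs_in0.
  by rewrite (_ : s + _ = i)//; lia.
case: (ex_minnP ex) => k /asboolP/IHn[l fl] kmin.
exists (snoc l (s + k%:Z)); rewrite snoc_last col'_snoc; split=> // j lt_jk.
have [lt_js|le_sj] := ltP j s; first by rewrite fs//; exact: coefs_in0.
apply: contrapT => fj; have := kmin (absz (j - s)).
have -> : s + (absz (j - s))%:Z = j by lia.
by move=> /(_ (asboolT fj)); lia.
Qed.

(** Serves to absorb the error term of [conv_mod_ideal] in [leadM]. *)
Lemma leadD n (f g : iterLaurentAlg A n) l :
  lead f l -> coefs_in g -> lead (f + g) l.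
Proof.
elim: n f g l => [|n IHn] f g l /=.
  move=> Pf Pg Pfg; apply: Pf; have [[_ PD PM] _ _] := primeP.
  by rewrite -[f](addrK g) -mulN1r; apply: PD => //; exact: PM.
move=> [fl ll] gl; split; last exact: IHn.
by move=> i /fl fi; apply: coefs_inD.
Qed.

(** In the outermost variable, the lowest surviving term is the product of the two leading
    coefficients; at the bottom, primality of [P] keeps the product outside [P]. *)
Lemma leadM n (f g : iterLaurentAlg A n) l l' :
  lead f l -> lead g l' -> lead (f * g) (l + l').
Proof.
elim: n f g l l' => [|n IHn] f g l l'.
  by have [_ _ +] := primeP => /= PM Pf Pg /PM[].
move=> /= [fl ll] [gl ll']; rewrite !mxE; set a := l 0 ord_max in fl ll *.
set b := l' 0 ord_max in gl ll' *.
have inM i j : i < a \/ j < b -> coefs_in (lcoef f i * lcoef g j).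
  by case=> [/fl|/gl] ?; [rewrite mulrC|]; apply: coefs_inM.
split=> [k klt|].
  have [|i _|z Iz fgE] := @conv_mod_ideal _ (@coefs_in n) f g k a.
  - exact: ideal_coefs_in.
  - by apply: inM; lia.
  - by rewrite [X in coefs_in X]fgE; apply: coefs_inD => //; apply: inM; lia.
have -> : col' ord_max (l + l') = col' ord_max l + col' ord_max l'.
  by apply/rowP => j; rewrite !mxE.
have [|i ia|z Iz fgE] := @conv_mod_ideal _ (@coefs_in n) f g (a + b) a.
- exact: ideal_coefs_in.
- by apply: inM; lia.
- by rewrite [X in lead X _]fgE; apply: leadD => //; rewrite [a + b]addrC addrK; exact: IHn.
Qed.

End LeadingExponent.

(** * Monomials and their neighborhoods *)

Section Monomials.
Variable R : comNzRingType.

Fact lmonom_bounded (i : int) (a : R) :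
  bounded_below (fun j => if j == i then a else 0).
Proof. by exists i => j ji; rewrite lt_eqF. Qed.

Definition lmonom i a : laurent R := mkLaurent (lmonom_bounded i a).

Lemma lmonomM i j a b : lmonom i a * lmonom j b = lmonom (i + j) (a * b).
Proof.
apply: laurentP => k.
(* For the zero ideal the error term vanishes. *)
have [||z -> ->] := @conv_mod_ideal _ [set 0] (lmonom i a) (lmonom j b) k i.
- by split=> // [x y -> ->|x y ->]; rewrite /= ?addr0 ?mulr0.
- by move=> p /negbTE pi; rewrite /= pi mul0r.
rewrite /= eqxx addr0 (_ : (k - i == j) = (k == i + j)); last by lia.
by case: ifP => //; rewrite mulr0.
Qed.

Lemma lmonom0 : lmonom 0 1 = 1.
Proof. by apply: laurentP => i; rewrite lcoef1 /=; case: eqP. Qed.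

End Monomials.

Section IteratedMonomials.
Variable A : comNzRingType.

Fixpoint monom (n : nat) : 'rV[int]_n -> iterLaurentAlg A n :=
  match n with
  | 0 => fun=> 1
  | n'.+1 => fun l => lmonom (l 0 ord_max) (monom (col' ord_max l))
  end.

Lemma monomD n (l l' : 'rV[int]_n) : monom (l + l') = monom l * monom l'.
Proof.
elim: n l l' => [|n IHn] l l' /=; first by rewrite mulr1.
rewrite lmonomM -IHn mxE; congr (lmonom _ (monom _)).
by apply/rowP => j; rewrite !mxE.
Qed.

Lemma monom0 n : monom (0 : 'rV[int]_n) = 1.
Proof.
elim: n => [//|n IHn] /=; rewrite mxE (_ : col' _ _ = 0) ?IHn ?lmonom0//.
by apply/rowP => j; rewrite !mxE.
Qed.

Lemma icoef_monom n (l k : 'rV[int]_n) : k <> l -> @icoef A n (monom l) k = 0.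
Proof.
elim: n l k => [|n IHn] l k kl /=; first by case: kl; apply/rowP; case.
case: eqP => [e|_]; last exact: icoef0.
by apply: IHn => ekl; apply: kl; rewrite -[k]snocK -[l]snocK ekl e.
Qed.

Lemma Ulam_monom n (lam : Lam n) l : ~ Zlam lam (- l) -> @Ulam A n lam (monom l).
Proof.
move=> lamN; apply/UlamP => k lamk; apply: icoef_monom => e.
by apply: lamN; rewrite -e opprK.
Qed.

End IteratedMonomials.

(** So every series in [Ulam (inhabLam n)] has coefficient 0 at t^0. *)
Lemma Zlam_inhab0 n : Zlam (inhabLam n) 0.
Proof.
elim: n => [//|[|n] IHn] /=; rewrite !mxE//; split=> //.
by rewrite (_ : col' _ _ = 0)//; apply/rowP => j; rewrite !mxE.
Qed.

(** If the last entry of [l] is nonzero, some multiple violates the bound on it. Otherwise the line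
    stays in the slice at 0, and induction applies to [lam.1 0]. *)
Lemma notin_Zlam_line n (l : 'rV[int]_n) (lam : Lam n) :
  l != 0 -> exists k : int, ~ Zlam lam (- (k *: l)).
Proof.
have pos (a b : int) : a != 0 -> exists k : int, - (k * a) < b.
  move=> a0; exists (a * (1 + `|b|)); rewrite mulrAC.
  by have : 1 <= a * a by [nia]; nia.
elim: n l lam => [|[|n] IHn] l lam l0.
- by case/eqP: l0; apply/rowP; case.
- have [|k kP] := pos (l 0 0) lam.
    apply: contra l0 => /eqP l0; apply/eqP/rowP => j; rewrite mxE -l0.
    by congr (l _ _); apply: val_inj; case: j => [[]].
  by exists k; rewrite /= !mxE; apply/negP; rewrite -ltNge.
have [e|ne] := eqVneq (l 0 ord_max) 0; last first.
  have [k kP] := pos _ lam.2 ne; exists k => -[+ _].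
  by rewrite !mxE leNgt kP.
have [|k kP] := IHn (col' ord_max l) (lam.1 0).
  by apply: contra l0 => /eqP c0; rewrite -[l]snocK c0 e; apply/eqP/rowP => j;
    rewrite !mxE; case: unlift => [i|] /=; rewrite ?mxE.
exists k => -[_]; rewrite !mxE e mulr0 oppr0.
rewrite (_ : col' _ _ = - (k *: col' ord_max l)) => [/kP//|].
by apply/rowP => j; rewrite !mxE.
Qed.

(** * Kernels of additive maps from Z^n to Z^m *)

Lemma int_mx_ker n m (M : 'M[int]_(n, m)) :
  (m < n)%N -> exists2 l : 'rV_n, l != 0 & l *m M = 0.
Proof.
case: n M => // n M le_mn; have [L Lu [R _ [d _ ->]]] := int_Smith_normal_form M.
(* The diagonal factor of the Smith form has more rows than columns, so its last row is zero. *)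
exists (delta_mx 0 ord_max *m invmx L).
  apply/negP => /eqP /(congr1 (mulmx^~ L)); rewrite mulmxKV// mul0mx.
  by move=> /matrixP/(_ 0 ord_max); rewrite !mxE !eqxx.
rewrite !mulmxA mulmxKV// -rowE (_ : row _ _ = 0) ?mul0mx//.
by apply/rowP => j; rewrite !mxE gtn_eqF ?mulr0n//=; have := ltn_ord j; lia.
Qed.

(** An additive map is right multiplication by the integer matrix whose rows are the images of the
    basis vectors. *)
Lemma additive_rV_ker n m (u : 'rV[int]_n -> 'rV[int]_m) :
  {morph u : l l' / l + l'} -> (m < n)%N ->
  exists2 l, l != 0 & forall k : int, u (k *: l) = 0.
Proof.
move=> uD lt_mn.
have uB : {morph u : l l' / l - l'} => [l l'|].
  by apply: (addIr (u l')); rewrite -uD !subrK.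
pose U : {additive 'rV[int]_n -> 'rV[int]_m} :=
  HB.pack u (GRing.isZmodMorphism.Build _ _ u uB).
have UE l : u l = l *m (\matrix_i u (delta_mx 0 i)).
  rewrite mulmx_sum_row -[u]/(U : _ -> _) {1}[l]row_sum_delta raddf_sum.
  by apply: eq_bigr => i _; rewrite rowK -[l 0 i]intz !scaler_int raddfMz.
have [l l0 lU] := int_mx_ker (\matrix_i u (delta_mx 0 i)) lt_mn.
by exists l => // k; rewrite UE -scalemxAl lU scaler0.
Qed.

Theorem corollary4p8 (A : comNzRingType) (n m : nat)
  (n_ge1 : (1 <= n)%N) (m_ge1 : (1 <= m)%N) (m_lt_n : (m < n)%N) :
  ~ exists phi : {lrmorphism iterLaurent A n -> iterLaurent A m},
      continuous phi.
Proof.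
move=> [phi phi_cont]; have [P primeP] := prime_ideal_ex A.
have /choice[u uP] l : exists l', lead P (phi (monom A l)) l'.
  (* The image of t^l is a unit, so it is not in the proper ideal [coefs_in]. *)
  apply: (lead_ex primeP) => phil; apply: (coefs_in1 primeP (n := m)).
  have <- : phi (monom A (- l)) * phi (monom A l) = 1.
    by rewrite -rmorphM -monomD addNr monom0 rmorph1.
  exact: (coefs_inM primeP).
have uD : {morph u : l l' / l + l'} => [l l'|].
  by apply: (lead_uniq (uP _)); rewrite monomD rmorphM;
    exact: leadM (uP _) (uP _).
have [l l0 ul0] := additive_rV_ker uD m_lt_n.
have [|lam lamP] := phi_cont 0 (Ulam (inhabLam m)).
  by exists (inhabLam m) => v; rewrite rmorph0 add0r.
(* Continuity puts phi t^(kl) in the fixed neighborhood, so its coefficient at t^0 is 0, although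
   its leading exponent is 0. *)
have [k /(@Ulam_monom A)/lamP] := notin_Zlam_line lam l0.
rewrite /= add0r => /UlamP/(_ 0); rewrite oppr0 => phik.
have /lead_icoef := uP (k *: l); rewrite ul0 phik.
  by apply; case: primeP => -[].
exact: Zlam_inhab0.
Qed.
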